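(* Let $\eta\in(0,1)$ be fixed, and let $P$ be sufficiently large in terms of $\eta$. Suppose that $\mathbf h=(h_1,h_2,h_4)\in\mathbb Z^3$ is a coefficient triple with the property that $T_2(P;\mathbf h)>P^\eta$. Then the tuple $\mathbf h$ satisfies one of the following two conditions: (a) for some integers $a$ and $b$ with $a\ne b$ and $1\le a,b\le P$, one has $h_j=a^j-b^j$ $(j=1,2,4)$, in which case $T_2(P;\mathbf h)=4P$; (b) one has $h_j=0$ $(j=1,2,4)$, in which case $T_2(P;\mathbf 0)=2P^2-P$. In particular, if $\mathbf h$ satisfies neither condition (a) nor condition (b), then $T_2(P;\mathbf h)=O(P^\varepsilon)$.
   Context: $P$ denotes a large positive integer. For an integer triple $\mathbf h=(h_1,h_2,h_4)\in\mathbb Z^3$ (indexed by $1,2,4$), $T_2(P;\mathbf h)$ denotes the number of integral solutions $(x_1,x_2,y_1,y_2)$ of the system $$x_1^j+x_2^j-y_1^j-y_2^j=h_j\quad (j=1,2,4),$$ with $1\le x_i,y_i\le P$ $(i=1,2)$. A statement involving $\varepsilon$ is asserted to hold for each $\varepsilon>0$.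
   Formalization: In case (a) the stated value T_2(P;h)=4P is false (the solutions {x}={a,t}, {y}={b,t} give only 2 orderings when t=a or t=b); the formal theorem proves the correct exact value 4P-4 instead. *)

(* Defs.v *)
From HB Require Import structures.
From mathcomp Require Import all_boot all_order all_algebra.
From mathcomp Require Import all_classical all_reals all_analysis.

Set Implicit Arguments.
Unset Strict Implicit.
Unset Printing Implicit Defensive.

Import Order.TTheory GRing.Theory Num.Theory.
Local Open Scope ring_scope.

Definition power_equation (P j : nat) (x1 x2 y1 y2 : 'I_P.+1) (h : int) : bool :=
  (x1 : nat)%:Z ^+ j + (x2 : nat)%:Z ^+ j
    - (y1 : nat)%:Z ^+ j - (y2 : nat)%:Z ^+ j == h.

(* The unknowns live in 'I_P.+1 = {0, ..., P}; the value 0 is excluded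
   explicitly, and the order of the unknowns matters. *)
Definition T2 (P : nat) (h1 h2 h4 : int) : nat :=
  #|[set v : 'I_P.+1 * 'I_P.+1 * 'I_P.+1 * 'I_P.+1 |
      let: (x1, x2, y1, y2) := v in
      [&& (0 < x1)%N, (0 < x2)%N, (0 < y1)%N, (0 < y2)%N,
          power_equation 1 x1 x2 y1 y2 h1,
          power_equation 2 x1 x2 y1 y2 h2 &
          power_equation 4 x1 x2 y1 y2 h4]]|.

(* For such h the solutions counted by T2 P are those with
   {x1, x2} = {a, t} and {y1, y2} = {b, t} as multisets, 1 <= t <= P.
   Each t gives 4 ordered solutions, except t = a and t = b, which give 2
   each; hence the value 4 P - 4, rather than 4 P, for their number. *)
Definition is_power_difference (P : nat) (h1 h2 h4 : int) : Prop :=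
  exists a b : int,
    [/\ a != b, 1 <= a <= P%:Z, 1 <= b <= P%:Z &
        [/\ h1 = a ^+ 1 - b ^+ 1, h2 = a ^+ 2 - b ^+ 2 & h4 = a ^+ 4 - b ^+ 4]].

Definition is_zero_triple (h1 h2 h4 : int) : Prop :=
  [/\ h1 = 0, h2 = 0 & h4 = 0].

(* Main.v *)
(** For a solution of the system put D = h2 h1^4 + h2^3 - 2 h1^2 h4 and
    A = h2 + h1^2. The identity
      D = (h1 (x1 + x2 + y1 + y2) + h2) (A - 2 h1 x1) (A - 2 h1 x2)
    does the work. If h1 and D are nonzero, x1 and x2 are determined by divisors
    of D, and then y1, y2 are determined up to order. If h1 <> 0 = D, then either
    some xi equals A / (2 h1), which forces h to be a power difference with
    a = xi, or h1 (x1 + x2 + y1 + y2) = - h2; in the latter case, with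
    u = x1 - x2 and v = y1 - y2, one has (u - v) (u + v) = 3 h2. If h1 = 0, then
    (u - v) (u + v) = 2 h2. So outside the two exceptional cases the number of
    solutions is at most 8 d(M)^2 for some positive M <= 56 P^6, and the bound
    d(M) = O(M^eps) concludes. *)

Require Import Defs.
From HB Require Import structures.
From mathcomp Require Import all_boot all_order all_algebra.
From mathcomp Require Import all_classical all_reals all_analysis.
From mathcomp Require Import ring lra zify.
Import Order.TTheory GRing.Theory Num.Theory.
Local Open Scope ring_scope.

Set Implicit Arguments.
Unset Strict Implicit.
Unset Printing Implicit Defensive.

(** * The divisor bound *)

(** With g = gcd(d, m), a divisor d of m n splits as g times d / g. Since d / g is coprime to m / g
    and divides (m / g) n, it divides n. So products of divisors of m and of n exhaust the divisors
    of m n. *)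
Lemma divisors_submul (m n : nat) : (0 < m)%N -> (0 < n)%N ->
  (size (divisors (m * n)) <= size (divisors m) * size (divisors n))%N.
Proof.
move=> m0 n0; rewrite -(size_allpairs (fun a b => a * b)%N).
apply: uniq_leq_size; first exact: divisors_uniq.
move=> d; rewrite -dvdn_divisors ?muln_gt0 ?m0// => dmn.
apply/allpairsP; exists (gcdn d m, d %/ gcdn d m)%N => /=.
rewrite -!dvdn_divisors ?dvdn_gcdr //; split=> //.
  have g0 : (0 < gcdn d m)%N by rewrite gcdn_gt0 m0 orbT.
  rewrite -(@Gauss_dvdr _ (m %/ gcdn d m)).
    by rewrite -(dvdn_pmul2l g0) mulnA ![(gcdn d m * _)%N]mulnC !divnK
      ?dvdn_gcdl ?dvdn_gcdr.
  by rewrite /coprime -(eqn_pmul2l g0) muln_gcdr muln1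
    ![(gcdn d m * _)%N]mulnC !divnK ?dvdn_gcdl ?dvdn_gcdr.
by rewrite mulnC divnK ?dvdn_gcdl.
Qed.

Lemma size_divisors_pfactor (p e : nat) : prime p ->
  (size (divisors (p ^ e)) <= e.+1)%N.
Proof.
move=> pp; rewrite -(size_iota 0 e.+1) -(size_map (expn p) (iota 0 e.+1)).
apply: uniq_leq_size; first exact: divisors_uniq.
move=> d; rewrite -dvdn_divisors ?expn_gt0 ?prime_gt0// => /(dvdn_pfactor _ _ pp)[i ie ->].
by apply: map_f; rewrite mem_iota add0n ltnS.
Qed.

(* From [e + 1 <= k (e / k + 1) <= k 2 ^ (e / k)], with [/] the integer quotient. *)
Lemma exp_succ_le (k e : nat) : (0 < k)%N -> (e.+1 ^ k <= k ^ k * 2 ^ e)%N.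
Proof.
move=> k0.
have h : (e.+1 <= k * 2 ^ (e %/ k))%N.
  apply: (@leq_trans (k * (e %/ k).+1)%N).
    by rewrite mulnC ltn_ceil.
  by rewrite leq_mul2l ltn_expl ?orbT.
apply: (@leq_trans ((k * 2 ^ (e %/ k)) ^ k)%N); first by rewrite leq_exp2r.
rewrite expnMn -expnM leq_mul2l.
by rewrite leq_exp2l ?leq_divM ?orbT.
Qed.

Lemma divisor_bound (k : nat) : (0 < k)%N ->
  exists C : nat, forall n, (0 < n)%N -> (size (divisors n) ^ k <= C * n)%N.
Proof.
(* A prime power p ^ e contributes (e + 1) ^ k / p ^ e, which is at most 1 when
   p >= 2 ^ k, and at most k ^ k for each of the fewer than 2 ^ k other primes. *)
move=> k0; pose c (p : nat) : nat := if (p < 2 ^ k)%N then (k ^ k)%N else 1%N.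
exists ((k ^ k) ^ (2 ^ k))%N => n n0.
have h1 : (size (divisors n) <=
    \prod_(f <- prime_decomp n) size (divisors (f.1 ^ f.2)))%N.
  rewrite [X in (size (divisors X) <= _)%N](prod_prime_decomp n0).
  have : all (fun f => 0 < f.1 ^ f.2)%N (prime_decomp n).
    apply/allP=> -[p e] /mem_prime_decomp[pp _ _] /=.
    by rewrite expn_gt0 prime_gt0.
  elim: (prime_decomp n) => [|f s IH] /=; first by rewrite !big_nil.
  move=> /andP[f0 s0]; rewrite !big_cons.
  apply: leq_trans (divisors_submul _ _) _ => //.
    by rewrite big_seq; apply: prodn_cond_gt0 => g /(allP s0).
  by rewrite leq_mul2l IH ?orbT.
have h2 : (size (divisors n) ^ k <=
    \prod_(f <- prime_decomp n) (c f.1 * f.1 ^ f.2))%N.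
  move: h1; rewrite -(leq_exp2r _ _ k0) => /leq_trans; apply.
  rewrite (big_morph (fun m => m ^ k)%N (fun m l => expnMn m l k) (exp1n k)) big_seq
    [X in (_ <= X)%N]big_seq.
  apply: leq_prod => -[p e] /mem_prime_decomp[pp e0 _] /=.
  have := size_divisors_pfactor e pp; rewrite -(leq_exp2r _ _ k0) => /leq_trans; apply.
  rewrite /c; case: ltnP => pk.
    apply: leq_trans (exp_succ_le e k0) _.
    by rewrite leq_mul2l leq_exp2r ?prime_gt1 ?orbT.
  (* For p >= 2 ^ k: (e + 1) ^ k <= (2 ^ e) ^ k = (2 ^ k) ^ e <= p ^ e. *)
  rewrite mul1n; apply: (@leq_trans ((2 ^ k) ^ e)%N); last by rewrite (leq_exp2r _ _ e0).
  by rewrite -expnM [(k * e)%N]mulnC expnM (leq_exp2r _ _ k0) ltn_expl.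
apply: leq_trans h2 _; rewrite big_split /= -prod_prime_decomp //.
rewrite leq_mul2r; apply/orP; right.
have -> : (\prod_(f <- prime_decomp n) c f.1 = \prod_(p <- primes n) c p)%N.
  by rewrite /primes big_map.
rewrite -big_mkcond /= big_const_seq iter_muln_1 leq_pexp2l ?expn_gt0 ?k0 //.
rewrite -size_filter -[X in (_ <= X)%N](size_iota 0); apply: uniq_leq_size.
  exact/filter_uniq/primes_uniq.
by move=> p; rewrite mem_filter mem_iota add0n => /andP[].
Qed.

(** * Counting through the divisors of a fixed integer *)

(** A signed divisor of M is coded by its absolute value and its sign, which gives 2 d(M) choices
    for each of f and g. The Boolean c gives the last factor 2 of 8 = 2 * 2 * 2. *)
Lemma card_le_divisors (T : finType) (S : {set T}) (M : nat)
    (f g : T -> int) (c : T -> bool) : (0 < M)%N ->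
  {in S, forall v, (`|f v|%N %| M)%N && (`|g v|%N %| M)%N} ->
  {in S &, forall v w, f v = f w -> g v = g w -> c v = c w -> v = w} ->
  (#|S| <= 8 * size (divisors M) ^ 2)%N.
Proof.
move=> M0 dvd inj.
pose code (z : int) := (`|z|%N, (0 <= z)).
pose D := [seq (a, b) | a <- divisors M, b <- [:: true; false]].
have DP z : (`|z|%N %| M)%N -> code z \in D.
  move=> zM; apply/allpairsP; exists (code z); split=> //=.
    by rewrite -dvdn_divisors.
  by case: (0 <= z).
pose E := [seq (p, b) | p <- [seq (x, y) | x <- D, y <- D], b <- [:: true; false]].
have sE : size E = (8 * size (divisors M) ^ 2)%N.
  by rewrite !size_allpairs /=; lia.
rewrite -sE cardE -(size_map (fun v => ((code (f v), code (g v)), c v)) (enum S)).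
apply: uniq_leq_size.
  rewrite map_inj_in_uniq ?enum_uniq // => v w; rewrite !mem_enum => vS wS.
  by move=> [] fa fs ga gs cE; apply: inj => //; lia.
move=> y /mapP[v]; rewrite mem_enum => vS ->.
have /andP[fv gv] := dvd v vS.
apply/allpairsP; exists ((code (f v), code (g v)), c v); split=> //=.
  by apply/allpairsP; exists (code (f v), code (g v)); split=> //=; apply: DP.
by case: (c v).
Qed.

(** * Algebra of the system over the integers *)

(** The hypotheses force x y = z w, so x is a root of (T - z) (T - w). *)
Lemma eq_two_power_sums (x y z w : int) :
  x + y = z + w -> x ^+ 2 + y ^+ 2 = z ^+ 2 + w ^+ 2 ->
  (x = z /\ y = w) \/ (x = w /\ y = z).
Proof.
move=> e1 e2; have /eqP : (x - z) * (x - w) = 0 by nia.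
by rewrite mulf_eq0 => /orP[] /eqP ?; [left|right]; lia.
Qed.

Definition solution (h1 h2 h4 x1 x2 y1 y2 : int) : Prop :=
  [/\ x1 + x2 - y1 - y2 = h1, x1 ^+ 2 + x2 ^+ 2 - y1 ^+ 2 - y2 ^+ 2 = h2 &
      x1 ^+ 4 + x2 ^+ 4 - y1 ^+ 4 - y2 ^+ 4 = h4].

(* Chosen so as to vanish on power differences; see [discr_factor]. *)
Definition discr (h1 h2 h4 : int) : int :=
  h2 * h1 ^+ 4 + h2 ^+ 3 - 2 * h1 ^+ 2 * h4.

Lemma discr_factor (h1 h2 h4 x1 x2 y1 y2 : int) :
  solution h1 h2 h4 x1 x2 y1 y2 ->
  discr h1 h2 h4 = (h1 * (x1 + x2 + y1 + y2) + h2) *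
    ((h2 + h1 ^+ 2 - 2 * h1 * x1) * (h2 + h1 ^+ 2 - 2 * h1 * x2)).
Proof. by rewrite /discr => -[<- <- <-]; ring. Qed.

Lemma solution_swap (h1 h2 h4 x1 x2 y1 y2 : int) :
  solution h1 h2 h4 x1 x2 y1 y2 -> solution h1 h2 h4 x2 x1 y1 y2.
Proof. by move=> [<- <- <-]; split; ring. Qed.

(** Cancelling a leaves y1 + y2 = b + x, and likewise for squares. *)
Lemma solution_cancel (h1 h2 h4 a b x y1 y2 : int) : h1 = a - b ->
  h2 = a ^+ 2 - b ^+ 2 -> solution h1 h2 h4 a x y1 y2 ->
  (y1 = b /\ y2 = x) \/ (y1 = x /\ y2 = b).
Proof.
by move=> e1 e2 [s1 s2 _]; apply: eq_two_power_sums; lia.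
Qed.

(** Here [discr] vanishes, and its first factor is (a - b) (x1 + x2 + y1 + y2 + a + b), nonzero by
    positivity. The other two factors are 2 (a - b) (a - xi), so some xi equals a, and
    [solution_cancel] gives y1 and y2. *)
Lemma power_difference_solution (a b x1 x2 y1 y2 : int) : a != b ->
  0 < a -> 0 < b -> 0 < x1 -> 0 < x2 -> 0 < y1 -> 0 < y2 ->
  solution (a - b) (a ^+ 2 - b ^+ 2) (a ^+ 4 - b ^+ 4) x1 x2 y1 y2 ->
  [\/ [/\ x1 = a, y1 = b & y2 = x2], [/\ x1 = a, y1 = x2 & y2 = b],
      [/\ x2 = a, y1 = b & y2 = x1] | [/\ x2 = a, y1 = x1 & y2 = b]].
Proof.
move=> ab a0 b0 x10 x20 y10 y20 s.
have := discr_factor s.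
have -> : discr (a - b) (a ^+ 2 - b ^+ 2) (a ^+ 4 - b ^+ 4) = 0.
  by rewrite /discr; ring.
have -> : (a - b) * (x1 + x2 + y1 + y2) + (a ^+ 2 - b ^+ 2)
  = (a - b) * (x1 + x2 + y1 + y2 + a + b) by ring.
have e x : a ^+ 2 - b ^+ 2 + (a - b) ^+ 2 - 2 * (a - b) * x
  = (a - b) * (2 * (a - x)) by ring.
have p0 : x1 + x2 + y1 + y2 + a + b != 0 by lia.
move=> /esym/eqP; rewrite !e !mulf_eq0 subr_eq0 (negPf ab) (negPf p0) /=.
move=> /orP[] /eqP ex.
- have xa : x1 = a by lia.
  by move: s; rewrite xa => /(solution_cancel (erefl _) (erefl _))[[]|[]] ? ?;
    [constructor 1 | constructor 2].
- have xa : x2 = a by lia.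
  by move: s; rewrite xa => /solution_swap/(solution_cancel (erefl _) (erefl _))[[]|[]] ? ?;
    [constructor 3 | constructor 4].
Qed.

Lemma zero_solution (x1 x2 y1 y2 : int) : solution 0 0 0 x1 x2 y1 y2 ->
  (y1 = x1 /\ y2 = x2) \/ (y1 = x2 /\ y2 = x1).
Proof. by move=> [s1 s2 _]; apply: eq_two_power_sums; lia. Qed.

(** The root condition says h2 = x1 ^ 2 - b ^ 2 with b = x1 - h1. By [solution_cancel], b is one of
    the yi, hence lies between 1 and P, and the other yi is x2, which therefore drops out of the
    quartic equation. *)
Lemma root_power_difference (P : nat) (h1 h2 h4 x1 x2 y1 y2 : int) :
  1 <= x1 <= P%:Z -> 1 <= x2 <= P%:Z -> 1 <= y1 <= P%:Z -> 1 <= y2 <= P%:Z ->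
  solution h1 h2 h4 x1 x2 y1 y2 -> h1 != 0 ->
  h2 + h1 ^+ 2 - 2 * h1 * x1 = 0 -> is_power_difference P h1 h2 h4.
Proof.
move=> x1P x2P y1P y2P s h10 r.
have e1 : h1 = x1 - (x1 - h1) by ring.
have e2 : h2 = x1 ^+ 2 - (x1 - h1) ^+ 2 by lia.
have [] := solution_cancel e1 e2 s => -[ey1 ey2];
  exists x1, (x1 - h1); (split; [by apply/eqP; lia | by [] | lia |]); split;
  rewrite ?expr1 //; case: s => s1 s2 <-; rewrite ey1 ey2; ring.
Qed.

(** * The finite solution set and its link to divisors *)

Definition bounded_solution (P : nat) (h1 h2 h4 x1 x2 y1 y2 : int) : Prop :=
  [/\ 1 <= x1 <= P%:Z, 1 <= x2 <= P%:Z, 1 <= y1 <= P%:Z, 1 <= y2 <= P%:Z &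
      solution h1 h2 h4 x1 x2 y1 y2].

(** A name for the set inside [T2], with the same body so that [T2E] holds by conversion. *)
Definition solutions (P : nat) (h1 h2 h4 : int) :
    {set 'I_P.+1 * 'I_P.+1 * 'I_P.+1 * 'I_P.+1} :=
  [set v : 'I_P.+1 * 'I_P.+1 * 'I_P.+1 * 'I_P.+1 | let: (x1, x2, y1, y2) := v in
     [&& (0 < x1)%N, (0 < x2)%N, (0 < y1)%N, (0 < y2)%N,
         power_equation 1 x1 x2 y1 y2 h1, power_equation 2 x1 x2 y1 y2 h2 &
         power_equation 4 x1 x2 y1 y2 h4]].

Lemma T2E (P : nat) (h1 h2 h4 : int) : T2 P h1 h2 h4 = #|solutions P h1 h2 h4|.
Proof. by []. Qed.

Lemma solutionsP (P : nat) (h1 h2 h4 : int) (x1 x2 y1 y2 : 'I_P.+1) :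
  reflect (bounded_solution P h1 h2 h4 (x1 : nat) (x2 : nat) (y1 : nat) (y2 : nat))
          ((x1, x2, y1, y2) \in solutions P h1 h2 h4).
Proof.
have bd (x : 'I_P.+1) : (0 < x)%N = (1 <= (x : nat)%:Z <= P%:Z).
  by have := ltn_ord x; lia.
rewrite inE !bd /power_equation !expr1; apply: (iffP idP).
  by case/and5P=> ? ? ? ? /and3P[/eqP ? /eqP ? /eqP ?].
by case=> -> -> -> -> [-> -> ->]; rewrite !eqxx.
Qed.

(** [card_le_divisors] carried over from ordinals to integers. The cofactor e leaves room for the
    third factor of [discr]. *)
Lemma T2_le_divisors (P : nat) (h1 h2 h4 N : int)
    (f g : int -> int -> int -> int -> int)
    (c : int -> int -> int -> int -> bool) : N != 0 ->
  (forall x1 x2 y1 y2, bounded_solution P h1 h2 h4 x1 x2 y1 y2 ->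
     exists e, N = e * (f x1 x2 y1 y2 * g x1 x2 y1 y2)) ->
  (forall x1 x2 y1 y2 z1 z2 w1 w2,
     bounded_solution P h1 h2 h4 x1 x2 y1 y2 ->
     bounded_solution P h1 h2 h4 z1 z2 w1 w2 ->
     f x1 x2 y1 y2 = f z1 z2 w1 w2 -> g x1 x2 y1 y2 = g z1 z2 w1 w2 ->
     c x1 x2 y1 y2 = c z1 z2 w1 w2 -> [/\ x1 = z1, x2 = z2, y1 = w1 & y2 = w2]) ->
  (T2 P h1 h2 h4 <= 8 * size (divisors `|N|%N) ^ 2)%N.
Proof.
move=> N0 dvd inj; rewrite T2E.
pose ev T (k : int -> int -> int -> int -> T)
    (v : 'I_P.+1 * 'I_P.+1 * 'I_P.+1 * 'I_P.+1) :=
  let: (x1, x2, y1, y2) := v in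
  k (x1 : nat)%:Z (x2 : nat)%:Z (y1 : nat)%:Z (y2 : nat)%:Z.
apply: (@card_le_divisors _ _ _ (ev _ f) (ev _ g) (ev _ c)).
- by rewrite absz_gt0.
- move=> [[[x1 x2] y1] y2] /solutionsP /dvd[e ->] /=.
  by rewrite !abszM; apply/andP; split; apply: dvdn_mull; [apply: dvdn_mulr | apply: dvdn_mull].
- move=> [[[x1 x2] y1] y2] [[[z1 z2] w1] w2] /solutionsP xs /solutionsP zs /= ef eg ec.
  have [[e1] [e2] [e3] [e4]] := inj _ _ _ _ _ _ _ _ xs zs ef eg ec.
  by congr (_, _, _, _); apply: val_inj.
Qed.

(** * Divisor bounds outside the exceptional cases *)

(** Let s = x1 + x2 = y1 + y2, u = x1 - x2 and v = y1 - y2. The divisors u - v and u + v of 2 h2 fix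
    u and v. Then 8 h4 = 12 h2 s ^ 2 + u ^ 4 - v ^ 4 fixes s ^ 2, hence the positive s. *)
Lemma T2_le_h1_eq0 (P : nat) (h2 h4 : int) : h2 != 0 ->
  (T2 P 0 h2 h4 <= 8 * size (divisors `|(2 * h2)%R|%N) ^ 2)%N.
Proof.
move=> h20; apply: (@T2_le_divisors P 0 h2 h4 (2 * h2)
  (fun x1 x2 y1 y2 => (x1 - x2) - (y1 - y2))
  (fun x1 x2 y1 y2 => (x1 - x2) + (y1 - y2)) (fun _ _ _ _ => true)).
- lia.
- move=> x1 x2 y1 y2 [_ _ _ _ [s1 s2 _]]; exists 1.
  rewrite -s2; have -> : y2 = x1 + x2 - y1 by lia.
  ring.
- move=> x1 x2 y1 y2 z1 z2 w1 w2 [? ? ? ? [s1 s2 s4]] [? ? ? ? [r1 r2 r4]] f g _.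
  have h4E (a b c d : int) : a + b - c - d = 0 ->
      8 * (a ^+ 4 + b ^+ 4 - c ^+ 4 - d ^+ 4) =
      6 * (a + b) ^+ 2 * (2 * (a ^+ 2 + b ^+ 2 - c ^+ 2 - d ^+ 2))
      + (a - b) ^+ 4 - (c - d) ^+ 4.
    by move=> e; (have -> : d = a + b - c by lia); ring.
  have := h4E _ _ _ _ s1; rewrite s2 s4.
  have := h4E _ _ _ _ r1; rewrite r2 r4.
  have -> : x1 - x2 = z1 - z2 by lia.
  have -> : y1 - y2 = w1 - w2 by lia.
  move=> -> e.
  (* The difference of the two expressions for 8 h4, divided by 12. *)
  have /eqP : h2 * ((x1 + x2 - z1 - z2) * (x1 + x2 + z1 + z2)) = 0.
    by clear - e; lra.
  rewrite !mulf_eq0 (negPf h20) /= => /orP[] /eqP q; clear s2 s4 r2 r4 e;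
    split; lia.
Qed.

(** The Boolean y1 <= y2 settles the order that the power sums leave open. *)
Lemma T2_le_discr_neq0 (P : nat) (h1 h2 h4 : int) : h1 != 0 ->
  discr h1 h2 h4 != 0 ->
  (T2 P h1 h2 h4 <= 8 * size (divisors `|discr h1 h2 h4|%N) ^ 2)%N.
Proof.
move=> h10 d0; apply: (@T2_le_divisors P h1 h2 h4 _
  (fun x1 x2 y1 y2 => h2 + h1 ^+ 2 - 2 * h1 * x1)
  (fun x1 x2 y1 y2 => h2 + h1 ^+ 2 - 2 * h1 * x2) (fun _ _ y1 y2 => y1 <= y2)).
- exact: d0.
- move=> x1 x2 y1 y2 [_ _ _ _ s].
  by exists (h1 * (x1 + x2 + y1 + y2) + h2); exact: discr_factor.
- move=> x1 x2 y1 y2 z1 z2 w1 w2 [? ? ? ? [s1 s2 s4]] [? ? ? ? [r1 r2 r4]] f g c.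
  have e1 : x1 = z1 by apply: (mulfI h10); lia.
  have e2 : x2 = z2 by apply: (mulfI h10); lia.
  subst z1 z2.
  have [] : (y1 = w1 /\ y2 = w2) \/ (y1 = w2 /\ y2 = w1).
  + by apply: eq_two_power_sums; lia.
  + by case=> -> ->.
  + by case=> a b; split=> //; lia.
Qed.

Lemma discr_eq0_solution (P : nat) (h1 h2 h4 : int) :
  ~ is_power_difference P h1 h2 h4 -> h1 != 0 -> discr h1 h2 h4 = 0 ->
  forall x1 x2 y1 y2, bounded_solution P h1 h2 h4 x1 x2 y1 y2 ->
  h1 * (x1 + x2 + y1 + y2) + h2 = 0.
Proof.
move=> npd h10 d0 x1 x2 y1 y2 [b1 b2 b3 b4 s].
have := discr_factor s; rewrite d0 => /esym/eqP.
rewrite !mulf_eq0 => /orP[/eqP//|/orP[]/eqP r]; case: npd.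
  exact: root_power_difference b1 b2 b3 b4 s h10 r.
exact: root_power_difference b2 b1 b3 b4 (solution_swap s) h10 r.
Qed.

(** Let s = x1 + x2, t = y1 + y2, u = x1 - x2 and v = y1 - y2. Then 2 h2 = s ^ 2 - t ^ 2 + u ^ 2 - v
    ^ 2, where s ^ 2 - t ^ 2 = h1 (s + t) = - h2, so u ^ 2 - v ^ 2 = 3 h2. Both s + t and s - t = h1
    are the same for all solutions, so u and v determine the solution. *)
Lemma T2_le_discr_eq0 (P : nat) (h1 h2 h4 : int) :
  ~ is_power_difference P h1 h2 h4 -> h1 != 0 -> discr h1 h2 h4 = 0 -> h2 != 0 ->
  (T2 P h1 h2 h4 <= 8 * size (divisors `|(3 * h2)%R|%N) ^ 2)%N.
Proof.
move=> npd h10 d0 h20.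
have w := discr_eq0_solution npd h10 d0.
apply: (@T2_le_divisors P h1 h2 h4 (3 * h2)
  (fun x1 x2 y1 y2 => (x1 - x2) - (y1 - y2))
  (fun x1 x2 y1 y2 => (x1 - x2) + (y1 - y2)) (fun _ _ _ _ => true)).
- lia.
- move=> x1 x2 y1 y2 b; have := w _ _ _ _ b; case: b => _ _ _ _ [s1 s2 _] e.
  by exists 1; rewrite -[LHS]subr0 -e -s1 -s2; ring.
- move=> x1 x2 y1 y2 z1 z2 w1 w2 b b' f g _.
  have e : x1 + x2 + y1 + y2 = z1 + z2 + w1 + w2.
    by apply: (mulfI h10); have := w _ _ _ _ b; have := w _ _ _ _ b'; lia.
  by case: b b' => _ _ _ _ [s1 _ _] [_ _ _ _ [r1 _ _]]; split; lia.
Qed.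

Lemma T2_divisor_bound (P : nat) (h1 h2 h4 : int) : (0 < P)%N ->
  ~ is_power_difference P h1 h2 h4 -> ~ is_zero_triple h1 h2 h4 ->
  exists M : nat, [/\ (0 < M)%N, (M <= 56 * P ^ 6)%N &
    (T2 P h1 h2 h4 <= 8 * size (divisors M) ^ 2)%N].
Proof.
move=> P0 npd nz.
have P6 : (0 < P ^ 6)%N by rewrite expn_gt0 P0.
(* Without solutions M = 1 serves. Otherwise a fixed solution bounds each hj by 2 P ^ j. *)
have [S0|[[[[x1 x2] y1] y2] /solutionsP b]] := set_0Vmem (solutions P h1 h2 h4).
  by exists 1%N; rewrite T2E S0 cards0; split=> //; lia.
have [b1 b2 b3 b4 s] := b; have [s1 s2 s4] := s.
have pow_le (x : int) k : 1 <= x <= P%:Z -> 0 <= x ^+ k <= P%:Z ^+ k.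
  by move=> xP; rewrite exprn_ge0 ?lerXn2r // ?nnegrE; lia.
have diff_le (k : nat) : `|(x1 : nat)%:Z ^+ k + (x2 : nat)%:Z ^+ k
    - (y1 : nat)%:Z ^+ k - (y2 : nat)%:Z ^+ k| <= 2 * P%:Z ^+ k.
  have := (pow_le _ k b1, pow_le _ k b2, pow_le _ k b3, pow_le _ k b4).
  by move=> [[[]]]; lia.
have h1le : `|h1| <= 2 * P%:Z by rewrite -s1; have := diff_le 1; rewrite !expr1.
have h2le : `|h2| <= 2 * P%:Z ^+ 2 by rewrite -s2.
have h4le : `|h4| <= 2 * P%:Z ^+ 4 by rewrite -s4.
have discr_le : `|discr h1 h2 h4| <= 56 * P%:Z ^+ 6.
  have X k (x y : int) : `|x| <= y -> `|x ^+ k| <= y ^+ k.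
    by move=> xy; rewrite normrX lerXn2r ?nnegrE // (le_trans _ xy).
  (* The three terms of [discr] contribute 32 + 8 + 16 = 56. *)
  have e : 56 * P%:Z ^+ 6 = (2 * P%:Z ^+ 2) * (2 * P%:Z) ^+ 4 + (2 * P%:Z ^+ 2) ^+ 3
      + 2 * (2 * P%:Z) ^+ 2 * (2 * P%:Z ^+ 4) by ring.
  rewrite e /discr (le_trans (ler_normB _ _)) ?lerD //.
    rewrite (le_trans (ler_normD _ _)) ?lerD ?X //.
    by rewrite normrM ler_pM // X.
  rewrite !normrM normr_nat; apply: ler_pM => //.
  by rewrite ler_pM2l // -normrM -expr2 X.
have h2M k : (k <= 20)%N -> (`|(k%:Z * h2)%R| <= 56 * P ^ 6)%N.
  move=> k20; have : (`|(k%:Z * h2)%R| <= 20 * (2 * P ^ 2))%N by rewrite abszM leq_mul //; lia.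
  move=> /leq_trans; apply; rewrite mulnA leq_mul // leq_pexp2l //.
have [h10|h10] := eqVneq h1 0.
  have h20 : h2 != 0.
    (* If h1 = h2 = 0, the yi are a permutation of the xi, so h4 = 0 too. *)
    apply/eqP => h20; apply: nz; split=> //.
    have [] : ((x1 : nat)%:Z = (y1 : nat)%:Z /\ (x2 : nat)%:Z = (y2 : nat)%:Z) \/
       ((x1 : nat)%:Z = (y2 : nat)%:Z /\ (x2 : nat)%:Z = (y1 : nat)%:Z).
    + by apply: eq_two_power_sums; lia.
    + by case=> e1 e2; rewrite -s4 e1 e2; ring.
    + by case=> e1 e2; rewrite -s4 e1 e2; ring.
  exists `|(2 * h2)%R|%N; split; [lia | exact: h2M | rewrite h10; exact: T2_le_h1_eq0].
have [d0|d0] := eqVneq (discr h1 h2 h4) 0.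
  have h20 : h2 != 0.
    (* With h2 = 0 the relation becomes h1 (x1 + x2 + y1 + y2) = 0, although the sum is positive. *)
    apply/eqP => h20; case/eqP: (h10).
    have := discr_eq0_solution npd h10 d0 b; rewrite h20 addr0 => /eqP.
    by rewrite mulf_eq0 (negPf h10) /= => /eqP; lia.
  exists `|(3 * h2)%R|%N; split; [lia | exact: h2M | exact: T2_le_discr_eq0].
exists `|discr h1 h2 h4|%N; split.
- by rewrite absz_gt0.
- lia.
- exact: T2_le_discr_neq0.
Qed.

(** * Exact counts in the exceptional cases *)

Lemma pos_ordE (P : nat) (x : 'I_P.+1) :
  (x != ord0) = (1 <= (x : nat)%:Z <= P%:Z).
Proof. by rewrite -val_eqE /= -lt0n; have := ltn_ord x; lia. Qed.

Lemma card_pos_ord (P : nat) : #|[set~ (ord0 : 'I_P.+1)]| = P.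
Proof. by rewrite cardsC1 card_ord. Qed.

(** Inclusion-exclusion: y = x and y = x swapped give P ^ 2 solutions each, and they share the P
    diagonal ones. The additive form avoids truncated subtraction. *)
Lemma T2_zero (P : nat) : (T2 P 0 0 0 + P = 2 * P ^ 2)%N.
Proof.
pose Q := [set~ (ord0 : 'I_P.+1)].
pose A := [set (p.1, p.2, p.1, p.2) | p in finset.setX Q Q].
pose B := [set (p.1, p.2, p.2, p.1) | p in finset.setX Q Q].
pose D := [set (x, x, x, x) | x in Q].
have cA : #|A| = (P * P)%N.
  by rewrite card_imset ?cardsX ?card_pos_ord // => -[? ?] [? ?] [-> ->].
have cB : #|B| = (P * P)%N.
  by rewrite card_imset ?cardsX ?card_pos_ord // => -[? ?] [? ?] [-> ->].
have cD : #|D| = P by rewrite card_imset ?card_pos_ord // => ? ? [].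
have memA x1 x2 y1 y2 : ((x1, x2, y1, y2) \in A) =
    [&& x1 \in Q, x2 \in Q, y1 == x1 & y2 == x2].
  apply/imsetP/and4P => [[[a b]] /finset.setXP[/= aQ bQ] [-> -> -> ->]|[x1Q x2Q /eqP-> /eqP->]].
    by rewrite !eqxx.
  by exists (x1, x2) => //; apply/finset.setXP.
have memB x1 x2 y1 y2 : ((x1, x2, y1, y2) \in B) =
    [&& x1 \in Q, x2 \in Q, y1 == x2 & y2 == x1].
  apply/imsetP/and4P => [[[a b]] /finset.setXP[/= aQ bQ] [-> -> -> ->]|[x1Q x2Q /eqP-> /eqP->]].
    by rewrite !eqxx.
  by exists (x1, x2) => //; apply/finset.setXP.
have -> : T2 P 0 0 0 = #|A :|: B|.
  rewrite T2E; apply: fintype.eq_card => -[[[x1 x2] y1] y2].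
  rewrite finset.in_setU memA memB !finset.in_setC1 !pos_ordE; apply/solutionsP/orP.
    case=> -> -> _ _ /zero_solution[] [/eqP e1 /eqP e2]; [left|right] => /=;
      by apply/andP; split.
  have sol0 (x y : int) : solution 0 0 0 x y x y /\ solution 0 0 0 x y y x.
    by split; split; ring.
  by case=> /and4P[x1P x2P /eqP-> /eqP->]; split=> //; have [] := sol0 x1 x2.
have cI : #|A :&: B| = P.
  rewrite -[RHS]cD; apply: fintype.eq_card => -[[[x1 x2] y1] y2].
  rewrite finset.in_setI memA memB; apply/andP/imsetP; last first.
    by case=> x xQ [-> -> -> ->]; rewrite xQ !eqxx.
  move=> [/and4P[x1Q x2Q /eqP-> /eqP->]] /and4P[_ _ /eqP e _].
  by exists x1; rewrite ?e.
by have := finset.cardsUI A B; rewrite cI cA cB; lia.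
Qed.

Lemma T2_power_difference (P : nat) (a b : 'I_P.+1) : a != b ->
  a != ord0 -> b != ord0 ->
  (T2 P ((a : nat)%:Z - (b : nat)%:Z) ((a : nat)%:Z ^+ 2 - (b : nat)%:Z ^+ 2)
     ((a : nat)%:Z ^+ 4 - (b : nat)%:Z ^+ 4) + 4 = 4 * P)%N.
Proof.
move=> ab a0 b0; set h1 := (X in T2 P X); set h2 := (X in T2 P _ X);
  set h4 := (X in T2 P _ _ X).
pose Q := [set~ (ord0 : 'I_P.+1)].
have [aQ bQ] : a \in Q /\ b \in Q by rewrite !finset.in_setC1.
have ba : b != a by rewrite eq_sym.
have cQ : #|Q| = P := card_pos_ord P.
(* Disjoint pieces: x1 = a and y1 = b; x1 = a and y1 <> b; x1 <> a and y1 = b;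
   x1 <> a and y1 <> b. *)
pose A1 := [set (a, t, b, t) | t in Q].
pose A2 := [set (a, t, t, b) | t in Q :\ b].
pose A3 := [set (t, a, b, t) | t in Q :\ a].
pose A4 := [set (t, a, t, b) | t in Q :\ a :\ b].
have c1 : #|A1| = P by rewrite card_imset ?card_pos_ord // => ? ? [].
have c2 : (#|A2| + 1 = P)%N.
  by rewrite card_imset => [|? ? []//]; move: cQ; rewrite (cardsD1 b) bQ; lia.
have c3 : (#|A3| + 1 = P)%N.
  by rewrite card_imset => [|? ? []//]; move: cQ; rewrite (cardsD1 a) aQ; lia.
have c4 : (#|A4| + 2 = P)%N.
  rewrite card_imset => [|? ? []//]; move: cQ.
  by rewrite (cardsD1 a) aQ (cardsD1 b (Q :\ a)) finset.in_setD1 ba bQ; lia.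
have mem1 x1 x2 y1 y2 : ((x1, x2, y1, y2) \in A1) =
    [&& x1 == a, y1 == b, y2 == x2 & x2 \in Q].
  by apply/imsetP/and4P => [[t tQ [-> -> -> ->]]|[/eqP-> /eqP-> /eqP-> tQ]];
    [rewrite tQ !eqxx | exists x2].
have mem2 x1 x2 y1 y2 : ((x1, x2, y1, y2) \in A2) =
    [&& x1 == a, y2 == b, y1 == x2 & x2 \in Q :\ b].
  by apply/imsetP/and4P => [[t tQ [-> -> -> ->]]|[/eqP-> /eqP-> /eqP-> tQ]];
    [rewrite tQ !eqxx | exists x2].
have mem3 x1 x2 y1 y2 : ((x1, x2, y1, y2) \in A3) =
    [&& x2 == a, y1 == b, y2 == x1 & x1 \in Q :\ a].
  by apply/imsetP/and4P => [[t tQ [-> -> -> ->]]|[/eqP-> /eqP-> /eqP-> tQ]];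
    [rewrite tQ !eqxx | exists x1].
have mem4 x1 x2 y1 y2 : ((x1, x2, y1, y2) \in A4) =
    [&& x2 == a, y2 == b, y1 == x1 & x1 \in Q :\ a :\ b].
  by apply/imsetP/and4P => [[t tQ [-> -> -> ->]]|[/eqP-> /eqP-> /eqP-> tQ]];
    [rewrite tQ !eqxx | exists x1].
have d12 : A1 :&: A2 = finset.set0.
  apply/finset.setP => -[[[x1 x2] y1] y2].
  rewrite finset.in_setI finset.in_set0 mem1 mem2 finset.in_setD1; apply/negP.
  move=> /andP[/and4P[_ /eqP e _ _] /and4P[_ _ /eqP <-]].
  by rewrite e eqxx.
have d123 : (A1 :|: A2) :&: A3 = finset.set0.
  apply/finset.setP => -[[[x1 x2] y1] y2].
  rewrite finset.in_setI finset.in_setU finset.in_set0 mem1 mem2 mem3 !finset.in_setD1.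
  by case: (x1 =P a); rewrite /= ?andbF.
have d1234 : (A1 :|: A2 :|: A3) :&: A4 = finset.set0.
  apply/finset.setP => -[[[x1 x2] y1] y2].
  rewrite finset.in_setI !finset.in_setU finset.in_set0 mem1 mem2 mem3 mem4.
  rewrite !finset.in_setD1; apply/negP => /andP[A123 /and4P[_ _ /eqP e /and3P[x1b x1a _]]].
  by move: A123; rewrite e (negPf x1a) (negPf x1b) !andbF.
have -> : T2 P h1 h2 h4 = #|A1 :|: A2 :|: A3 :|: A4|.
  rewrite T2E; apply: fintype.eq_card => -[[[x1 x2] y1] y2].
  rewrite !finset.in_setU mem1 mem2 mem3 mem4; rewrite !(finset.in_setD1, finset.in_setC1).
  apply/solutionsP/idP.
    case=> b1 b2 b3 b4 s.
    have zi (x y : 'I_P.+1) : (x : nat)%:Z = (y : nat)%:Z -> x = y by case=> /val_inj.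
    have abz : (a : nat)%:Z != (b : nat)%:Z by apply: contraNneq ab => /zi ->.
    have pos (x : 'I_P.+1) : x != ord0 -> 0 < (x : nat)%:Z by rewrite pos_ordE; lia.
    move: b1 b2 b3 b4; rewrite -!pos_ordE => b1 b2 b3 b4.
    have := power_difference_solution abz (pos _ a0) (pos _ b0) (pos _ b1) (pos _ b2)
      (pos _ b3) (pos _ b4) s.
    (* The four forms overlap when the free value t is a or b; the case splits below send such
       solutions to an earlier piece. *)
    case=> -[/zi ? /zi ? /zi ?]; subst; rewrite ?b1 ?b2 !eqxx ?ab ?ba ?a0 ?b0 ?andbT ?orbT //=.
    - by case: eqP => // ->; rewrite ?eqxx ?orbT.
    - by case: eqP => // ->; rewrite ?eqxx ?orbT.
    - case: (x1 =P a) => [->|_]; rewrite ?ab ?eqxx ?orbT //=.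
      by case: (x1 =P b) => [->|_]; rewrite ?eqxx ?orbT.
  rewrite -!orbA => /or4P[] /and4P[/eqP-> /eqP-> /eqP->] xQ; split;
    rewrite -?pos_ordE ?a0 ?b0 //; try by [case/and3P: xQ | case/andP: xQ];
    by split; rewrite /h1 /h2 /h4; ring.
have := finset.cardsUI (A1 :|: A2 :|: A3) A4; have := finset.cardsUI (A1 :|: A2) A3.
have := finset.cardsUI A1 A2; rewrite d12 d123 d1234 !finset.cards0; lia.
Qed.

Lemma T2_is_zero_triple (P : nat) (h1 h2 h4 : int) : is_zero_triple h1 h2 h4 ->
  (T2 P h1 h2 h4)%:Z = 2 * P%:Z ^+ 2 - P%:Z.
Proof. by move=> [-> -> ->]; have := T2_zero P; lia. Qed.

Lemma T2_is_power_difference (P : nat) (h1 h2 h4 : int) :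
  is_power_difference P h1 h2 h4 -> (T2 P h1 h2 h4)%:Z = 4 * P%:Z - 4.
Proof.
move=> [a [b [ab aP bP [-> -> ->]]]]; rewrite !expr1.
have ord_of (x : int) : 1 <= x <= P%:Z ->
    exists2 i : 'I_P.+1, i != ord0 & x = (i : nat)%:Z.
  move=> xP; have xn : (`|x|%N < P.+1)%N by lia.
  have xE : x = (Ordinal xn : nat)%:Z by rewrite /=; lia.
  by exists (Ordinal xn) => //; rewrite pos_ordE -xE.
have [[i i0 ea] [j j0 eb]] := (ord_of a aP, ord_of b bP).
have ij : i != j by apply: contraNneq ab => e; rewrite ea eb e.
by rewrite ea eb; have := T2_power_difference ij i0 j0; set t := T2 _ _ _ _; lia.
Qed.

(** * From divisor bounds to powers of P *)

(** From d(M) ^ k <= C0 M <= 56 C0 P ^ 6 follows d(M) ^ 2 <= (56 C0) ^ (2 / k) P ^ (12 / k). *)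
Lemma T2_small (R : realType) (eps : R) : 0 < eps -> exists C : R,
  forall P : nat, (0 < P)%N -> forall h1 h2 h4 : int,
    ~ is_power_difference P h1 h2 h4 -> ~ is_zero_triple h1 h2 h4 ->
    (T2 P h1 h2 h4)%:R <= C * P%:R `^ eps.
Proof.
(* Chosen so that 12 / k <= eps; the successor makes k visibly positive. *)
move=> eps0; pose k := (Num.bound (12 / eps)).+1.
have k0 : (0 < k%:R :> R) by rewrite ltr0n.
have k_eps : 6%:R * (2 / k%:R) <= eps.
  have lt_k : 12 / eps < k%:R.
    apply: lt_trans (archi_boundP _) _; first by rewrite divr_ge0 // ltW.
    by rewrite ltr_nat.
  rewrite mulrA ler_pdivrMr //; move: lt_k; rewrite ltr_pdivrMr // => /ltW.
  by rewrite mulrC => /(le_trans _); apply; lra.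
have [C0 dC0] := @divisor_bound k isT.
exists (8 * (C0 * 56)%:R `^ (2 / k%:R)) => P P0 h1 h2 h4 npd nz.
have [M [M0 MP T2M]] := T2_divisor_bound P0 npd nz.
set d := size (divisors M) in T2M.
have dk : d%:R ^+ k <= (C0 * 56)%:R * P%:R ^+ 6 :> R.
  rewrite -!natrX -natrM ler_nat; apply: leq_trans (dC0 M M0) _.
  by rewrite -mulnA leq_mul2l MP orbT.
apply: (@le_trans _ _ (8 * d%:R ^+ 2)).
  by rewrite -natrX -natrM ler_nat.
rewrite -mulrA ler_pM2l //.
have -> : d%:R ^+ 2 = (d%:R ^+ k) `^ (2 / k%:R) :> R.
  by rewrite -!powR_mulrn // -powRrM mulrC divfK // gt_eqF.
apply: (@le_trans _ _ (((C0 * 56)%:R * P%:R ^+ 6) `^ (2 / k%:R))).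
  have le0 : 0 <= (C0 * 56)%:R * P%:R ^+ 6 :> R by rewrite mulr_ge0 ?exprn_ge0.
  by apply: ge0_ler_powR; rewrite ?nnegrE ?exprn_ge0 // divr_ge0 ?(ltW k0).
rewrite powRM ?exprn_ge0 // ler_wpM2l ?powR_ge0 //.
by rewrite -powR_mulrn // -powRrM ler_powR // ler1n.
Qed.

Theorem theorem1p3 (R : realType) :
  (forall eta : R, 0 < eta < 1 ->
    exists P0 : nat, forall P : nat, (P0 <= P)%N ->
    forall h1 h2 h4 : int,
      P%:R `^ eta < (T2 P h1 h2 h4)%:R :> R ->
      (is_power_difference P h1 h2 h4 /\
         (T2 P h1 h2 h4)%:Z = 4 * P%:Z - 4) \/
      (is_zero_triple h1 h2 h4 /\
         (T2 P h1 h2 h4)%:Z = 2 * P%:Z ^+ 2 - P%:Z)) /\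
  (forall eps : R, 0 < eps ->
    exists C : R, forall P : nat, (0 < P)%N ->
    forall h1 h2 h4 : int,
      ~ is_power_difference P h1 h2 h4 ->
      ~ is_zero_triple h1 h2 h4 ->
      (T2 P h1 h2 h4)%:R <= C * P%:R `^ eps).
Proof.
split=> [eta /andP[eta0 _]|]; last exact: T2_small.
have eta20 : 0 < eta / 2 by rewrite divr_gt0.
have [C T2C] := T2_small eta20.
(* Beyond this threshold |C| <= P ^ (eta / 2). The absolute value is taken since the sign of C is
   unknown; the successor ensures P > 0. *)
exists (Num.bound (`|C| `^ (2 / eta))).+1 => P PP h1 h2 h4 T2P.
have [pd|npd] := pselect (is_power_difference P h1 h2 h4).
  by left; split=> //; exact: T2_is_power_difference.
have [z|nz] := pselect (is_zero_triple h1 h2 h4).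
  by right; split=> //; exact: T2_is_zero_triple.
have P0 : (0 < P)%N by apply: leq_trans PP.
have CP : C <= P%:R `^ (eta / 2).
  apply: le_trans (ler_norm C) _.
  have -> : `|C| = (`|C| `^ (2 / eta)) `^ (eta / 2).
    by rewrite -powRrM mulrA divfK ?gt_eqF // divff // powRr1.
  apply: ge0_ler_powR; rewrite ?nnegrE ?powR_ge0 ?(ltW eta20) //.
  apply/ltW/(lt_le_trans (archi_boundP (powR_ge0 _ _))).
  by rewrite ler_nat ltnW.
(* Otherwise P ^ eta < C P ^ (eta / 2) <= P ^ eta. *)
have := lt_le_trans T2P (T2C P P0 h1 h2 h4 npd nz).
rewrite ltNge => /negP[].
have -> : P%:R `^ eta = P%:R `^ (eta / 2) * P%:R `^ (eta / 2) :> R.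
  by rewrite -powRD -?splitr // pnatr_eq0 -lt0n P0 implybT.
by rewrite ler_wpM2r ?powR_ge0.
Qed.
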